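(* Let $(R,\mathfrak m)$ be a commutative Noetherian local ring. Then the following conditions are equivalent: (i) $R$ is a Cohen-Macaulay ring. (ii) For any parameter ideals $\mathfrak a$ and $\mathfrak b$ of $R$ with $\mathfrak b\subseteq\mathfrak a$, there is an isomorphism of $R$-modules $\operatorname{Hom}_R(R/\mathfrak a,R/\mathfrak b)\cong R/\mathfrak a$.
   Context: A parameter ideal of a Noetherian local ring $(R,\mathfrak m)$ of dimension $d$ is an ideal generated by a system of parameters of $R$, i.e. by $d$ elements $x_1,\dots,x_d\in\mathfrak m$ such that $\sqrt{(x_1,\dots,x_d)}=\mathfrak m$ (when $d=0$ the only parameter ideal is the zero ideal). *)

(* Defs.v *)
From HB Require Import structures.
From mathcomp Require Import all_boot all_order all_algebra.
From mathcomp Require Import ring_quotient.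
From mathcomp Require Import boolp functions.

Set Implicit Arguments.
Unset Strict Implicit.
Unset Printing Implicit Defensive.

Import GRing.Theory.
Local Open Scope ring_scope.
Local Open Scope quotient_scope.

(* [idealr R] and [prime_idealr R] are the library's structures of proper, resp.
   prime, ideals, given by boolean predicates. With the classical axioms of
   [boolp] every proper ideal is of this form. *)

Section QuotientModule.
Variables (R : comNzRingType) (I : idealr R).
Implicit Types u v : {ideal_quot I}.

Definition quot_scale (c : R) u : {ideal_quot I} := \pi_{ideal_quot I} c * u.

Lemma quot_scaleA c d u : quot_scale c (quot_scale d u) = quot_scale (c * d) u.
Proof. by rewrite /quot_scale mulrA -rmorphM. Qed.

Lemma quot_scale1 : left_id 1 quot_scale.
Proof. by move=> u; rewrite /quot_scale rmorph1 mul1r. Qed.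

Lemma quot_scaleDr : right_distributive quot_scale +%R.
Proof. by move=> c u v; rewrite /quot_scale mulrDr. Qed.

Lemma quot_scaleDl u : {morph quot_scale^~ u : c d / c + d}.
Proof. by move=> c d; rewrite /quot_scale rmorphD mulrDl. Qed.

HB.instance Definition _ := GRing.Zmodule_isLmodule.Build R {ideal_quot I}
  quot_scaleA quot_scale1 quot_scaleDr quot_scaleDl.

End QuotientModule.

Section HomModule.
Variables (R : comNzRingType) (U V : lmodType R).

Definition linear_pred : {pred U -> V} := fun f => `[< linear f >].

Lemma linear_pred_submod : submod_closed linear_pred.
Proof.
split=> [|c f g /asboolP lf /asboolP lg]; apply/asboolP => k x y.
  by rewrite [LHS]/(0 : V) [X in k *: X + _]/(0 : V) scaler0 addr0.
rewrite -[LHS]/(c *: f (k *: x + y) + g (k *: x + y)).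
rewrite -[RHS]/(k *: (c *: f x + g x) + (c *: f y + g y)).
by rewrite lf lg !scalerDr !scalerA mulrC addrACA.
Qed.

HB.instance Definition _ :=
  GRing.isSubmodClosed.Build R (U -> V) linear_pred
    linear_pred_submod.

(* Hom_R(U, V) with the pointwise R-module structure. *)
Record Rhom := MkRhom { rhom_fun :> U -> V; _ : rhom_fun \in linear_pred }.

HB.instance Definition _ := [isSub for rhom_fun].
HB.instance Definition _ := [Choice of Rhom by <:].
HB.instance Definition _ := [SubChoice_isSubLmodule of Rhom by <:].

End HomModule.

Definition lmod_isomorphic (R : nzRingType) (U V : lmodType R) : Prop :=
  exists f : {linear U -> V}, bijective f.

Section LocalAlgebra.
Variable R : comNzRingType.
Implicit Types (I J m a : idealr R) (xs : seq R).

Definition in_span xs (y : R) : Prop :=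
  exists c : 'I_(size xs) -> R, y = \sum_(i < size xs) c i * xs`_i.

Definition generates xs I : Prop := forall y, y \in I <-> in_span xs y.

(* Only proper ideals are tested: the unit ideal is generated by 1. *)
Definition noetherian : Prop := forall I, exists xs, generates xs I.

Definition maximal_ideal I : Prop :=
  forall J, {subset I <= J} -> {subset J <= I}.

Definition local_ring m : Prop :=
  maximal_ideal m /\ forall I, maximal_ideal I -> I =i m.

Definition prime_chain (n : nat) (P : 'I_n.+1 -> prime_idealr R) : Prop :=
  forall i j : 'I_n.+1, (i < j)%N ->
    {subset P i <= P j} /\ ~ {subset P j <= P i}.

Definition krull_dim (d : nat) : Prop :=
  (exists P : 'I_d.+1 -> prime_idealr R, prime_chain P) /\
  forall n (P : 'I_n.+1 -> prime_idealr R), prime_chain P -> (n <= d)%N.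

Definition regular_seq xs : Prop :=
  (forall i, (i < size xs)%N ->
     forall y, in_span (take i xs) (xs`_i * y) -> in_span (take i xs) y) /\
  ~ in_span xs 1.

Definition depth m (n : nat) : Prop :=
  (exists xs, [/\ {subset xs <= m}, regular_seq xs & size xs = n]) /\
  forall xs, {subset xs <= m} -> regular_seq xs -> (size xs <= n)%N.

Definition cohen_macaulay m : Prop := exists d, krull_dim d /\ depth m d.

Definition radical_is I J : Prop :=
  forall y, y \in J <-> exists n, y ^+ n \in I.

Definition parameter_ideal m a : Prop :=
  exists (d : nat) (xs : d.-tuple R),
    [/\ krull_dim d, {subset xs <= m}, generates xs a & radical_is a m].

End LocalAlgebra.

Arguments noetherian : clear implicits.
Arguments krull_dim : clear implicits.

(* Main.v *)
(* Hom(R/a, R/b) is (b : a)/b, so condition (ii) says that b : a = b + (w) with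
   b : w = a for some w.

   If R is Cohen-Macaulay, all systems of parameters are regular sequences. The class
   of (b : a)/b does not change when the last element y of a regular sequence (J, y)
   generating b is exchanged for another element x of a regular modulo J. Any two
   regular sequences of the same length in a are linked by such exchanges (choose z in a
   regular modulo all partial ideals of both, exchange the last elements for z, move z
   to the front), so (b : a)/b is isomorphic to (a : a)/a = R/a.

   Conversely, let (s, x) be a system of parameters. Applying (ii) to a = (s, x) and
   b = (s, x^n) for large n, cyclicity of (b : a)/b forces x to be regular modulo (s).
   For a system of parameters (s, x, t) this gives that x is regular modulo (s, t^n) for
   all n, hence modulo (s) by Krull's intersection theorem. *)

From HB Require Import structures.
Require Import Defs.
From mathcomp Require Import all_boot all_order all_algebra.
From mathcomp Require Import ring_quotient.
From mathcomp Require Import boolp functions ring.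

Set Implicit Arguments.
Unset Strict Implicit.
Unset Printing Implicit Defensive.

Import GRing.Theory.
Local Open Scope ring_scope.

(** * Ideals of Noetherian rings *)

Reserved Notation "I [<=] J" (at level 70).

Section Ideals.
Variable R : comNzRingType.

(* Unlike [idealr], these need be neither proper nor boolean. *)
Record ideal := Ideal {
  ideal_mem :> R -> Prop;
  ideal_mem0 : ideal_mem 0;
  ideal_memPD : forall c x y,
    ideal_mem x -> ideal_mem y -> ideal_mem (c * x + y) }.

Implicit Types I J K L M N P Q : ideal.

Definition isub (I J : ideal) := forall x, I x -> J x.
Notation "I [<=] J" := (isub I J).

Lemma ideal_ext (I J : ideal) : I [<=] J -> J [<=] I -> I = J.
Proof.
case: I J => [I I0 IP] [J J0 JP] /= sIJ sJI.
have eIJ : I = J by apply/funext => x; apply/propext; split; [exact: sIJ|exact: sJI].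
by case: J / eIJ J0 JP {sIJ sJI} => J0 JP; congr Ideal; apply: Prop_irrelevance.
Qed.

Lemma imem1 (I : ideal) x (c y : R) : I x -> y = c * x -> I y.
Proof. by move=> Ix ->; rewrite -[_ * _]addr0; apply: ideal_memPD => //; apply: ideal_mem0. Qed.

Lemma imem2 (I : ideal) x1 x2 (c1 c2 y : R) :
  I x1 -> I x2 -> y = c1 * x1 + c2 * x2 -> I y.
Proof. by move=> Ix1 Ix2 ->; apply: ideal_memPD => //; apply: imem1 Ix2 _. Qed.

Lemma imem3 (I : ideal) x1 x2 x3 (c1 c2 c3 y : R) :
  I x1 -> I x2 -> I x3 -> y = c1 * x1 + c2 * x2 + c3 * x3 -> I y.
Proof.
move=> I1 I2 I3 ->; rewrite -addrA; apply: ideal_memPD => //.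
by apply: imem2 I2 I3 _.
Qed.

Lemma imem_eq (I : ideal) x y : I x -> y = x -> I y.
Proof. by move=> Ix ->. Qed.

Lemma imem0 (I : ideal) y : y = 0 -> I y.
Proof. by move=> ->; apply: ideal_mem0. Qed.

Lemma imemM (I : ideal) c x : I x -> I (c * x).
Proof. by move=> Ix; apply: imem1 Ix _. Qed.

Lemma isub_refl I : I [<=] I. Proof. by move=> x. Qed.
#[local] Hint Resolve isub_refl : core.
Lemma isub_trans J I K : I [<=] J -> J [<=] K -> I [<=] K.
Proof. by move=> sIJ sJK x /sIJ/sJK. Qed.

#[local] Obligation Tactic := idtac.

Program Definition izero := @Ideal (eq^~ 0) _ _.
Next Obligation. by []. Qed.
Next Obligation. by move=> c _ _ -> ->; rewrite mulr0 addr0. Qed.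

Program Definition iunit := @Ideal (fun=> True) _ _.
Next Obligation. by []. Qed.
Next Obligation. by []. Qed.

Program Definition iadd (I J : ideal) := @Ideal (fun y => exists2 k, I k & J (y - k)) _ _.
Next Obligation. by move=> I J; exists 0; [|rewrite subrr]; apply: ideal_mem0. Qed.
Next Obligation.
move=> I J c x y [k Ik Jk] [l Il Jl]; exists (c * k + l); first exact: ideal_memPD.
by apply: (imem2 (c1 := c) (c2 := 1) Jk Jl); ring.
Qed.

Program Definition adj (I : ideal) (x : R) := @Ideal (fun y => exists c, I (y - c * x)) _ _.
Next Obligation. by move=> I x; exists 0; apply: imem0; ring. Qed.
Next Obligation.
move=> I z c x y [k Ik] [l Il]; exists (c * k + l).
by apply: (imem2 (c1 := c) (c2 := 1) Ik Il); ring.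
Qed.

Program Definition colon (I : ideal) (u : R) := @Ideal (fun x => I (x * u)) _ _.
Next Obligation. by move=> I u; apply: imem0; ring. Qed.
Next Obligation.
by move=> I z c x y Ix Iy; apply: (imem2 (c1 := c) (c2 := 1) Ix Iy); ring.
Qed.

(** The product ideal as the intersection of all ideals containing the products, a form that avoids
    finite sums. *)
Program Definition imul (I J : ideal) :=
  @Ideal (fun y => forall L : ideal, (forall b n, I b -> J n -> L (b * n)) -> L y) _ _.
Next Obligation. by move=> I J L _; apply: ideal_mem0. Qed.
Next Obligation.
by move=> I J c x y Lx Ly L HL; apply: ideal_memPD; [apply: Lx|apply: Ly].
Qed.

Program Definition iscale (I : ideal) (g : R) := @Ideal (fun y => exists2 b, I b & y = b * g) _ _.
Next Obligation. by move=> I g; exists 0; [apply: ideal_mem0|rewrite mul0r]. Qed.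
Next Obligation.
move=> I g c _ _ [x Ix ->] [y Iy ->]; exists (c * x + y); first exact: ideal_memPD.
ring.
Qed.

Definition primeI (P : ideal) := ~ P 1 /\ forall x y, P (x * y) -> P x \/ P y.

Lemma primeM P x y : primeI P -> ~ P x -> ~ P y -> ~ P (x * y).
Proof. by move=> [_ HP] nx ny /HP[]. Qed.

Lemma primeX P x n : primeI P -> P (x ^+ n) -> P x.
Proof.
move=> [P1 HP]; elim: n => [|n IHn]; first by rewrite expr0 => /P1.
by rewrite exprS => /HP[].
Qed.

Lemma prime_sub P s : primeI P -> ~ P s -> forall b, P b -> ~ P (s - b).
Proof. by move=> _ nPs b Pb Psb; apply: nPs; apply: (imem2 (c1 := 1) (c2 := 1) Pb Psb); ring. Qed.

(* The contraction of the localization of [I] at the prime [Q]. *)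
Program Definition sat (Q : ideal) (hQ : primeI Q) (I : ideal) :=
  @Ideal (fun y => exists2 s, ~ Q s & I (s * y)) _ _.
Next Obligation. by move=> Q [Q1 _] I; exists 1 => //; apply: imem0; ring. Qed.
Next Obligation.
move=> Q hQ I c x y [s Qs Is] [t Qt It]; exists (s * t); first exact: primeM.
by apply: (imem2 (c1 := c * t) (c2 := s) Is It); ring.
Qed.

Lemma sub_sat Q (hQ : primeI Q) I : I [<=] sat hQ I.
Proof. by move=> x Ix; exists 1; [case: hQ|rewrite mul1r]. Qed.

Lemma sat_mono Q (hQ : primeI Q) I J : I [<=] J -> sat hQ I [<=] sat hQ J.
Proof. by move=> sIJ x [s Qs /sIJ]; exists s. Qed.

Lemma sat_idem Q (hQ : primeI Q) I : sat hQ (sat hQ I) [<=] sat hQ I.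
Proof.
move=> x [s Qs [t Qt It]]; exists (t * s); first exact: primeM.
by rewrite -mulrA.
Qed.

Lemma sub_adj I x : I [<=] adj I x.
Proof. by move=> y Iy; exists 0; apply: (imem_eq Iy); ring. Qed.

Lemma mem_adj I x : adj I x x.
Proof. by exists 1; apply: imem0; ring. Qed.

Lemma adj_sub I J x : I [<=] J -> J x -> adj I x [<=] J.
Proof.
by move=> sIJ Jx y [c /sIJ Jy]; apply: (imem2 (c1 := 1) (c2 := c) Jy Jx); ring.
Qed.

Lemma adjAC I x y : adj (adj I x) y = adj (adj I y) x.
Proof.
have sub a b : adj (adj I a) b [<=] adj (adj I b) a.
  apply: adj_sub; last by apply: sub_adj; apply: mem_adj.
  by apply: adj_sub; [move=> z Iz; do 2 apply: sub_adj|apply: mem_adj].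
exact: ideal_ext.
Qed.

Fixpoint span (I : ideal) (xs : seq R) :=
  if xs is x :: xs' then span (adj I x) xs' else I.

Lemma span_cat I s t : span I (s ++ t) = span (span I s) t.
Proof. by elim: s I => //= x s IHs I. Qed.

Lemma span_rcons I s x : span I (rcons s x) = adj (span I s) x.
Proof. by rewrite -cats1 span_cat. Qed.

Lemma sub_span I s : I [<=] span I s.
Proof. by elim: s I => //= x s IHs I; apply: isub_trans (IHs _); apply: sub_adj. Qed.

Lemma mem_span I s x : x \in s -> span I s x.
Proof.
elim: s I => //= y s IHs I; rewrite in_cons => /orP[/eqP->|/IHs//].
by apply: sub_span; apply: mem_adj.
Qed.

Lemma span_sub I J s : I [<=] J -> (forall x, x \in s -> J x) -> span I s [<=] J.
Proof.
elim: s I => //= x s IHs I sIJ sJ; apply: IHs => [|y ys].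
  by apply: adj_sub => //; apply: sJ; rewrite mem_head.
by apply: sJ; rewrite in_cons ys orbT.
Qed.

Lemma spanP I s y : span I s y <->
  exists c : 'I_(size s) -> R, I (y - \sum_(i < size s) c i * s`_i).
Proof.
elim: s I => [|x s IHs] I /=.
  split=> [Iy|[c]]; last by rewrite big_ord0 subr0.
  by exists (fun=> 0); rewrite big_ord0 subr0.
rewrite IHs; split=> [[c [e Ie]]|[c Ic]].
  exists (fun i => if unlift ord0 i is Some j then c j else e).
  rewrite big_ord_recl unlift_none /=.
  under eq_bigr => i _ do rewrite liftK.
  by apply: (imem_eq Ie); ring.
exists (fun i => c (lift ord0 i)); exists (c ord0).
by move: Ic; rewrite big_ord_recl /= => Ic; apply: (imem_eq Ic); ring.
Qed.

Lemma in_spanP s y : in_span s y <-> span izero s y.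
Proof.
rewrite spanP; split=> -[c Hc]; exists c => /=; first by rewrite Hc subrr.
by apply/eqP; rewrite -subr_eq0; apply/eqP.
Qed.

Lemma span_perm I s t : perm_eq s t -> span I s = span I t.
Proof.
move=> /perm_mem est; apply: ideal_ext; apply: span_sub; try exact: sub_span;
  by move=> x xs; apply: mem_span; rewrite ?est // -est.
Qed.

Program Definition of_idealr (a : idealr R) := @Ideal (fun x => x \in a) _ _.
Next Obligation. by move=> a; apply: idealr0. Qed.
Next Obligation. by move=> a c x y ax ay /=; rewrite rpredD // idealMr. Qed.

Lemma of_idealr1 (a : idealr R) : ~ of_idealr a 1.
Proof. by rewrite /= idealr1. Qed.

Lemma to_idealr I : ~ I 1 -> exists a : idealr R, of_idealr a = I.
Proof.
move=> nI1; pose S := fun x : R => `[< I x >].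
have S_closed : idealr_closed S.
  split; rewrite ?unfold_in; first by apply/asboolP/ideal_mem0.
    by apply/negP => /asboolP.
  move=> c x y /asboolP Ix /asboolP Iy; apply/asboolP.
  exact: ideal_memPD.
pose SR : idealr R := HB.pack S (isIdealr.Build R S S_closed).
by exists SR; apply: ideal_ext => x /asboolP.
Qed.

Section Noetherian.
Hypothesis noethR : noetherian R.

Lemma ideal_fg (I : ideal) : exists s, I = span izero s.
Proof.
have [I1|nI1] := pselect (I 1).
  exists [:: 1]; apply: ideal_ext => x _ /=; first by exists x => /=; ring.
  by apply: (imem1 (c := x) I1); ring.
have [a <-] := to_idealr nI1; have [s gs] := noethR a.
exists s; apply: ideal_ext => x /=; first by move=> /gs/in_spanP.
by move=> /in_spanP/gs.
Qed.

(** Otherwise choice yields a strictly ascending chain in [F]; its union is finitely generated, and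
    one member already contains all generators. *)
Lemma noeth_max (F : ideal -> Prop) I0 : F I0 ->
  exists I, [/\ F I, I0 [<=] I & forall J, F J -> I [<=] J -> J [<=] I].
Proof.
move=> FI0; apply: contrapT => nomax.
pose T := {I : ideal | F I /\ I0 [<=] I}.
have step (I : T) : exists J : T, sval I [<=] sval J /\ ~ sval J [<=] sval I.
  case: I => I [FI sI]; apply: contrapT => nJ; apply: nomax; exists I; split=> // J FJ sIJ.
  apply: contrapT => nsJI; apply: nJ.
  by exists (exist _ J (conj FJ (isub_trans sI sIJ))).
have /choice[f Hf] := step.
pose start : T := exist _ I0 (conj FI0 (@isub_refl I0)).
pose ch n := sval (iter n f start).
have chS n : ch n [<=] ch n.+1 by case: (Hf (iter n f start)).
have chNS n : ~ ch n.+1 [<=] ch n by case: (Hf (iter n f start)).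
have ch_mono i j : (i <= j)%N -> ch i [<=] ch j.
  move=> /subnK <-; elim: (j - i)%N => //= n IHn x /IHn.
  by rewrite addSn; apply: chS.
have U0 : exists n, ch n 0 by exists 0%N; apply: ideal_mem0.
have UP c x y : (exists n, ch n x) -> (exists n, ch n y) -> exists n, ch n (c * x + y).
  move=> [i ix] [j jy]; exists (maxn i j); apply: ideal_memPD.
    exact: ch_mono (leq_maxl _ _) _ ix.
  exact: ch_mono (leq_maxr _ _) _ jy.
have [s Us] := ideal_fg (Ideal U0 UP).
have [N HN] : exists N : nat, forall x, x \in s -> ch N x.
  have : forall x, x \in s -> exists n, ch n x.
    move=> x xs; suff : Ideal U0 UP x by [].
    by rewrite Us; apply: mem_span.
  elim: s {Us} => [|x s IHs] Hs; first by exists 0%N.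
  have [|N HN] := IHs; first by move=> y ys; apply: Hs; rewrite in_cons ys orbT.
  have [|n Hn] := Hs x; first by rewrite mem_head.
  exists (maxn n N) => y; rewrite in_cons => /orP[/eqP->|/HN].
    exact: ch_mono (leq_maxl _ _) _ Hn.
  exact: ch_mono (leq_maxr _ _) _.
apply: (chNS N) => x xN; have : Ideal U0 UP x by exists N.+1.
by rewrite Us; apply: span_sub => // y ->; apply: ideal_mem0.
Qed.

(** * Associated primes, minimal primes and prime avoidance *)

Definition assI (I P : ideal) := primeI P /\ exists u, ~ I u /\ P = colon I u.

(** A maximal annihilator [colon I v] is prime: if [x * y] is in it and [y] is not, maximality shows
    [colon I (y * v)], which contains [x], to be no larger. *)
Lemma exists_ass I u : ~ I u -> exists2 P, assI I P & colon I u [<=] P.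
Proof.
move=> nIu; pose F K := exists v, ~ I v /\ K = colon I v.
have [|K [[v [nIv eK]] sK Kmax]] := @noeth_max F (colon I u); first by exists u.
exists K => //; split; last by exists v.
rewrite eK; split=> /=; first by rewrite mul1r.
move=> x y Ixy; have [Iyv|nIyv] := pselect (I (y * v)); first by right.
left; have := Kmax (colon I (y * v)); rewrite eK; apply => /=.
- by exists (y * v).
- by move=> z /= Iz; apply: (imem1 (c := y) Iz); ring.
- by apply: (imem_eq Ixy); ring.
Qed.

Lemma maxI_above I : ~ I 1 ->
  exists M, [/\ ~ M 1, I [<=] M & forall J, ~ J 1 -> M [<=] J -> J [<=] M].
Proof. exact: (@noeth_max (fun J => ~ J 1)). Qed.

(** If [I] contains no power of [y], an ideal above [I] maximal with this property is prime, yet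
    misses [y]. *)
Lemma radical_primes I y : (forall P, primeI P -> I [<=] P -> P y) -> exists n, I (y ^+ n).
Proof.
move=> Hy; apply: contrapT => /forallNP nI.
have [P [nP sIP Pmax]] := @noeth_max (fun J => forall n, ~ J (y ^+ n)) I nI.
have pP : primeI P.
  split=> [P1|a b Pab]; first by apply: (nP 0%N); rewrite expr0.
  apply: contrapT => /not_orP[nPa nPb].
  have ex c : ~ P c -> exists n, adj P c (y ^+ n).
    move=> nPc; apply: contrapT => /forallNP nPc'; apply: nPc.
    by apply: (Pmax (adj P c)) => //; [apply: sub_adj|apply: mem_adj].
  have [i [e ei]] := ex a nPa; have [j [f fj]] := ex b nPb.
  apply: (nP (i + j)%N); rewrite exprD.
  by apply: (imem3 (c1 := y ^+ j) (c2 := e * a) (c3 := e * f) ei fj Pab); ring.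
by apply: (nP 1%N); rewrite expr1; apply: Hy.
Qed.

(* An ideal maximal among those [J] for which only finitely many associated primes of
   [I] are annihilators of elements of [J] must be the unit ideal. *)
Lemma finite_ass I : exists Ps : seq ideal,
  forall P, assI I P -> List.In P Ps.
Proof.
pose F J := exists Ps : seq ideal,
  forall u, J u -> primeI (colon I u) -> List.In (colon I u) Ps.
have [|J [[Ps HPs] sIJ Jmax]] := @noeth_max F I.
  exists [::] => u Iu [n1 _]; apply: n1 => /=; rewrite mul1r //.
have [J1|] := pselect (J 1).
  exists Ps => P [pP [u [_ eP]]]; rewrite eP; apply: HPs; last by rewrite -eP.
  by apply: (imem1 (c := u) J1); ring.
move=> /exists_ass[P [pP [v [nJv eP]]] _]; exfalso.
apply: nJv; apply: (Jmax (adj J v)); [|exact: sub_adj|exact: mem_adj].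
exists (P :: Ps) => u [c Jc] pu; rewrite /=.
have [Ju|nJu] := pselect (J u); first by right; apply: HPs.
have nPc : ~ P c.
  rewrite eP /= => Jcv; apply: nJu.
  by apply: (imem2 (c1 := 1) (c2 := 1) Jc Jcv); ring.
have suP : colon I u [<=] P.
  move=> r /= Iru; have : P (r * c).
    by rewrite eP /=; apply: (imem2 (c1 := 1) (c2 := - r) (sIJ _ Iru) Jc); ring.
  by case: pP => _ pP' /pP'[].
(* Either [colon I u] is the new prime [P], or some [p] in [P] lies outside it. Then [u] and [p * u]
   have the same annihilator modulo [I] by primality, and [p * u] lies in [J], where [Ps]
   suffices. *)
have [sPu|/existsNP[p /not_implyP[Pp npu]]] := pselect (P [<=] colon I u).
  by left; apply: ideal_ext.
have epu : colon I u = colon I (p * u).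
  apply: ideal_ext => r /= Ir; first by apply: (imem1 (c := p) Ir); ring.
  have /(proj2 pu)[] : colon I u (r * p) by apply: (imem_eq Ir); ring.
    by [].
  by move/npu.
right; rewrite epu; apply: HPs.
  move: Pp; rewrite eP /= => Jpv.
  by apply: (imem2 (c1 := p) (c2 := c) Jc Jpv); ring.
by rewrite -epu.
Qed.

(** Take [J] maximal such that every prime over [I] contains a listed prime or [J]. If [J] is proper
    and [P = J : v] is prime, a prime over [J] contains [P] or [v]; listing [P] thus enlarges [J] to
    [(J, v)]. *)
Lemma finite_min_primes I : exists Ps : seq ideal,
  List.Forall (fun P => primeI P /\ I [<=] P) Ps /\
  forall Q, primeI Q -> I [<=] Q -> exists2 P, List.In P Ps & P [<=] Q.
Proof.
pose F J := exists Ps : seq ideal,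
  List.Forall (fun P => primeI P /\ I [<=] P) Ps /\
  forall Q, primeI Q -> I [<=] Q -> (exists2 P, List.In P Ps & P [<=] Q) \/ J [<=] Q.
have [|J [[Ps [HPs1 HPs2]] sIJ Jmax]] := @noeth_max F I.
  by exists [::]; split=> [|Q _ sIQ]; [constructor|right].
have [J1|] := pselect (J 1).
  exists Ps; split=> // Q pQ sIQ; have [//|sJQ] := HPs2 Q pQ sIQ.
  by case: pQ => /(_ (sJQ _ J1)).
move=> /exists_ass[P [pP [v [nJv eP]]] _]; exfalso.
apply: nJv; apply: (Jmax (adj J v)); [|exact: sub_adj|exact: mem_adj].
exists (P :: Ps); split.
  constructor => //; split=> // x /sIJ Jx; rewrite eP /=.
  by apply: (imem1 (c := v) Jx); ring.
move=> Q pQ sIQ; have [[P' inP' sP'Q]|sJQ] := HPs2 Q pQ sIQ.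
  by left; exists P' => //=; right.
have [sPQ|/existsNP[p /not_implyP[Pp npQ]]] := pselect (P [<=] Q).
  by left; exists P => //=; left.
right; apply: adj_sub => //; move: Pp; rewrite eP /= => /sJQ /(proj2 pQ)[] //.
Qed.

End Noetherian.

(** If the element [z] found for the other primes lies in [P], add some [w] in [a] outside [P] that
    lies in every other prime not inside [P]. The primes inside [P] are avoided because [P] is. *)
Lemma prime_avoidance (a : ideal) (Ps : seq ideal) :
  List.Forall (fun P => primeI P /\ ~ a [<=] P) Ps ->
  exists2 z, a z & List.Forall (fun P : ideal => ~ P z) Ps.
Proof.
elim: Ps => [|P Ps IHPs] HPs.
  by exists 0; [apply: ideal_mem0|constructor].
have [pP naP] := List.Forall_inv HPs; have {}HPs := List.Forall_inv_tail HPs.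
have [z az Hz] := IHPs HPs.
have [Pz|nPz] := pselect (P z); last by exists z => //; constructor.
have [w [aw nPw Hw]] : exists w, [/\ a w, ~ P w &
    List.Forall (fun P' : ideal => P' w \/ P' [<=] P) Ps].
  elim: Ps {HPs Hz IHPs} => [|P' Ps [w [aw nPw Hw]]].
    have /existsNP[w /not_implyP[aw nPw]] := naP.
    by exists w; split=> //; constructor.
  have [sP'P|/existsNP[p /not_implyP[P'p nPp]]] := pselect (P' [<=] P).
    by exists w; split=> //; constructor => //; right.
  exists (w * p); split; [by rewrite mulrC; apply: imemM|exact: primeM|].
  constructor; first by left; apply: imemM.
  apply: List.Forall_impl Hw => K [Kw|sK]; [left|by right].
  by rewrite mulrC; apply: imemM.
have nPzw : ~ P (z + w).
  move=> Pzw; apply: nPw.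
  by apply: (imem2 (c1 := 1) (c2 := - 1) Pzw Pz); ring.
exists (z + w); first by apply: (imem2 (c1 := 1) (c2 := 1) az aw); ring.
constructor => //; elim: Ps Hz Hw {HPs IHPs} => [|K Ps IHPs] Hz Hw; constructor.
  case: (List.Forall_inv Hw) => [Kw|sKP /sKP//] Kzw.
  apply: (List.Forall_inv Hz).
  by apply: (imem2 (c1 := 1) (c2 := - 1) Kzw Kw); ring.
exact: IHPs (List.Forall_inv_tail Hz) (List.Forall_inv_tail Hw).
Qed.

End Ideals.

Notation "I [<=] J" := (isub I J).
#[local] Hint Resolve isub_refl : core.

(** * The height theorem *)

Section KrullHeight.
Variable R : comNzRingType.
Hypothesis noethR : noetherian R.
Implicit Types I J K L M N P Q : ideal R.

(* No generators of [N] are needed: an ideal maximal among the [Q]-saturated ideals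
   containing [K] but not [N] cannot exist. *)
Lemma nakayama Q (hQ : primeI Q) (B N K : ideal R) : B [<=] Q ->
  N [<=] sat hQ (iadd K (imul B N)) -> N [<=] sat hQ K.
Proof.
move=> sBQ HN; apply: contrapT => nNK.
pose F J := [/\ K [<=] J, sat hQ J [<=] J & ~ N [<=] J].
have [|J [[sKJ satJ nNJ] _ Jmax]] := @noeth_max _ noethR F (sat hQ K).
  by split=> //; [apply: sub_sat|apply: sat_idem].
have /existsNP[g /not_implyP[Ng nJg]] := nNJ.
have HJg : N [<=] sat hQ (adj J g).
  apply: contrapT => nN; apply: nJg; apply: (Jmax (sat hQ (adj J g))).
  - split=> //; last exact: sat_idem.
    exact: isub_trans sKJ (isub_trans (@sub_adj _ J g) (@sub_sat _ _ hQ _)).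
  - exact: isub_trans (@sub_adj _ J g) (@sub_sat _ _ hQ _).
  - by apply: sub_sat; apply: mem_adj.
have HBN : imul B N [<=] sat hQ (iadd J (iscale B g)).
  move=> y; apply=> b n Bb /HJg[s nQs [c Jc]].
  exists s => //; exists (b * (s * n - c * g)); first exact: imemM.
  exists (c * b); first exact: imemM.
  ring.
(* Here [(t * s - b) * g] lies in [J], and [t * s - b] is outside [Q] because [b] is in [Q];
   saturation puts [g] into [J]. *)
have [s nQs [k Kk /HBN[t nQt [j Jj [b Bb eb]]]]] := HN g Ng.
apply: nJg; apply: satJ; exists (t * s - b).
  by apply: prime_sub; [|apply: primeM|apply: sBQ].
apply: (imem2 (c1 := t) (c2 := 1) (sKJ _ Kk) Jj).
have -> : j = t * (s * g - k) - b * g by rewrite -eb; ring.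
ring.
Qed.

Lemma descending_mono (K : nat -> ideal R) : (forall n, K n.+1 [<=] K n) ->
  forall i j, (i <= j)%N -> K j [<=] K i.
Proof.
move=> HK i j /subnK <-; elim: (j - i)%N => [//|n IHn].
by rewrite addSn; apply: isub_trans (HK _) IHn.
Qed.

(* The localization of [R / I] at a minimal prime [Q] of [I] is Artinian. *)
Lemma dcc Q (hQ : primeI Q) I (K : nat -> ideal R) :
    (forall P, primeI P -> I [<=] P -> P [<=] Q -> Q [<=] P) ->
    (forall n, K n.+1 [<=] K n) -> (forall n, I [<=] K n) ->
    (forall n, sat hQ (K n) [<=] K n) ->
  exists n, K n [<=] K n.+1.
Proof.
move=> Qmin Kdec sIK satK.
pose F J := [/\ I [<=] J, sat hQ J [<=] J &
  exists N : nat, forall n, (N <= n)%N -> forall y, J y -> K n y -> K n.+1 y].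
have [|J [[sIJ satJ [N HN]] _ Jmax]] := @noeth_max _ noethR F (sat hQ I).
  split; [exact: sub_sat|exact: sat_idem|exists 0%N => n _ y [s nQs Isy] _].
  by apply: satK; exists s => //; apply: sIK.
have [J1|] := pselect (J 1).
  exists N => y; apply: HN => //; apply: (imem1 (c := y) J1); ring.
move=> /(exists_ass noethR)[P [pP [u [nJu eP]]] _]; exfalso; apply: nJu.
have sPQ : P [<=] Q.
  move=> s; rewrite eP /= => Jsu; apply: contrapT => nQs.
  by case: pP => + _; apply; rewrite eP /= mul1r; apply: satJ; exists s.
have {}Qmin : Q [<=] P.
  apply: Qmin => // x Ix; rewrite eP /=.
  by apply: (imem1 (c := u) (sIJ _ Ix)); ring.
have sJJ' : J [<=] sat hQ (adj J u).
  exact: isub_trans (@sub_adj _ J u) (@sub_sat _ _ hQ _).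
apply: (Jmax (sat hQ (adj J u))) => //; last by apply: sub_sat; apply: mem_adj.
split; [exact: isub_trans sIJ sJJ'|exact: sat_idem|].
(* If the traces of the chain on the enlarged ideal end up inside [J], they stabilize as they do on
   [J]. Otherwise each [K n.+1] contains some [w] of the enlarged ideal outside [J]; its coefficient
   [c] at [u] is outside [Q], so a multiple of [w] moves a multiple of [y] into [J]. *)
have [[n0 Hn0]|/forallNP Hn] := pselect (exists n0, forall y, K n0 y -> sat hQ (adj J u) y -> J y).
  exists (maxn N n0) => n; rewrite geq_max => /andP[leN len0] y J'y Ky.
  by apply: HN => //; apply: Hn0 => //; apply: descending_mono len0 _ Ky.
exists N => n leN y [t nQt [e Je]] Ky.
have /existsNP[w /not_implyP[Kw /not_implyP[[s nQs [c Jc]] nJw]]] := Hn n.+1.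
have nQc : ~ Q c.
  move=> /Qmin; rewrite eP /= => Jcu; apply: nJw; apply: satJ; exists s => //.
  by apply: (imem2 (c1 := 1) (c2 := 1) Jc Jcu); ring.
apply: satK; exists (c * t); first exact: primeM.
have Jv : J (c * t * y - e * s * w).
  by apply: (imem2 (c1 := c) (c2 := - e) Je Jc); ring.
have Kv : K n.+1 (c * t * y - e * s * w).
  apply: HN => //.
  by apply: (imem2 (c1 := c * t) (c2 := - (e * s)) Ky (Kdec _ _ Kw)); ring.
by apply: (imem2 (c1 := 1) (c2 := e * s) Kv Kw); ring.
Qed.

Fixpoint ipow P n := if n is n'.+1 then imul P (ipow P n') else iunit R.

Lemma mem_imul I J x y : I x -> J y -> imul I J (x * y).
Proof. by move=> Ix Jy L; apply. Qed.

Lemma mem_ipow P x n : P x -> ipow P n (x ^+ n).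
Proof. by move=> Px; elim: n => // n IHn; rewrite exprS; apply: mem_imul. Qed.

Lemma iadd_mono I I' J : I [<=] I' -> iadd I J [<=] iadd I' J.
Proof. by move=> sI x [k /sI Ik Jk]; exists k. Qed.

Lemma iaddl I J : I [<=] iadd I J.
Proof. by move=> x Ix; exists x => //; apply: imem0; ring. Qed.

Lemma iaddr I J : J [<=] iadd I J.
Proof.
by move=> x Jx; exists 0; [apply: ideal_mem0|apply: (imem_eq Jx); ring].
Qed.

(* By [dcc] applied to the symbolic powers of [P1] modulo [P0]. *)
Lemma principal_ideal_theorem P0 P1 Q x :
    primeI P0 -> primeI P1 -> primeI Q -> P0 [<=] P1 -> ~ P1 [<=] P0 ->
    P1 [<=] Q -> ~ Q [<=] P1 -> Q x ->
  exists P, [/\ primeI P, P0 [<=] P, P x, P [<=] Q & ~ Q [<=] P].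
Proof.
move=> p0 p1 pQ s01 n10 s1Q nQ1 Qx; apply: contrapT => noP; apply: n10.
have nP1x : ~ P1 x by move=> P1x; apply: noP; exists P1.
pose symb n := sat p1 (iadd (ipow P1 n) P0).
have symb_dec n : symb n.+1 [<=] symb n.
  apply: sat_mono; apply: iadd_mono => y; apply=> b z _ Hz; exact: imemM.
have symbM n s y : ~ P1 s -> symb n (s * y) -> symb n y.
  by move=> nP1s Hy; apply: (@sat_idem _ _ p1); exists s.
have [||||n Hn] := @dcc Q pQ (adj P0 x) (fun n => sat pQ (adj (symb n) x)).
- move=> P pP sP0P sPQ; apply: contrapT => nQP; apply: noP; exists P; split=> //.
    exact: isub_trans (@sub_adj _ _ _) sP0P.
  by apply: sP0P; apply: mem_adj.
- move=> n; apply: sat_mono; apply: adj_sub; last exact: mem_adj.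
  exact: isub_trans (symb_dec n) (@sub_adj _ _ _).
- move=> n; apply: isub_trans (@sub_sat _ _ pQ _).
  apply: adj_sub; last exact: mem_adj.
  apply: isub_trans (@sub_adj _ _ _); apply: isub_trans (@sub_sat _ _ p1 _).
  exact: iaddr.
- by move=> n; apply: sat_idem.
(* Up to a factor outside [Q], an element of [symb n] is [x * c] modulo [symb n.+1]. As [x] is not
   in [P1], [c] lies in [symb n], and Nakayama for [(x)] applies. *)
have symb_stable : symb n [<=] symb n.+1.
  have : symb n [<=] sat pQ (symb n.+1).
    apply: (@nakayama Q pQ (adj (izero R) x)).
      by apply: adj_sub => // y ->; apply: ideal_mem0.
    move=> u symu; have [|s nQs [c Hc]] := Hn u.
      by apply: sub_sat; apply: sub_adj.
    exists s => //; exists (s * u - c * x) => //.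
    apply: (@imem_eq _ _ (x * c)); last by ring.
    apply: mem_imul; first exact: mem_adj.
    apply: (symbM n x) => //.
    by apply: (imem2 (c1 := s) (c2 := -1) symu (symb_dec _ _ Hc)); ring.
  by move=> H u /H[s nQs]; apply: symbM => /s1Q.
(* Locally at [P1], stability puts the [n]-th power of [P1] into [P0] plus the next power, so
   Nakayama applies again. *)
have : ipow P1 n [<=] sat p1 P0.
  apply: (@nakayama P1 p1 P1) => // u Hu.
  have [|s nP1s [k Hk P0k]] := symb_stable u.
    by apply: sub_sat; apply: iaddl.
  exists s => //; exists (s * u - k) => //; apply: (imem_eq Hk); ring.
move=> H y P1y; have [s nP1s /(proj2 p0)[/s01//|]] := H _ (mem_ipow n P1y).
exact: primeX.
Qed.

(** A strict chain of primes of length [n] from [P] to a prime inside [Q]: for primes [P] and [Q],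
    the height of [Q / P] is at least [n]. *)
Fixpoint prime_height_ge n P Q :=
  if n is n'.+1 then exists P', [/\ primeI P', P [<=] P', ~ P' [<=] P & prime_height_ge n' P' Q]
  else P [<=] Q.

Lemma prime_height_ge_sub n P Q : prime_height_ge n P Q -> P [<=] Q.
Proof.
elim: n P => //= n IHn P [P' [_ sPP' _ /IHn]]; exact: isub_trans.
Qed.

Lemma prime_height_geS n P Q Q' : prime_height_ge n P Q -> primeI Q' ->
  Q [<=] Q' -> ~ Q' [<=] Q -> prime_height_ge n.+1 P Q'.
Proof.
move=> + pQ' sQ nQ; elim: n P => [|n IHn] P.
  move=> sPQ; exists Q'; split=> //=; first exact: isub_trans sPQ sQ.
  by move=> sQ'P; apply: nQ; apply: isub_trans sQ'P sPQ.
by move=> [P' [pP' sPP' nP' /IHn]]; exists P'.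
Qed.

(* The principal ideal theorem pushes [x] down the chain, one step at a time. *)
Lemma chain_through n P Q x : primeI P -> primeI Q -> Q x ->
  prime_height_ge n.+1 P Q ->
  exists P', [/\ primeI P', P [<=] P', P' x & prime_height_ge n P' Q].
Proof.
move=> + pQ Qx; elim: n P => [|n IHn] P pP [P1 [pP1 sP1 nP1 H1]].
  by exists Q; split=> //=; apply: isub_trans sP1 H1.
have [P1x|nP1x] := pselect (P1 x); first by exists P1.
have [P2 [pP2 s12 P2x H2]] := IHn P1 pP1 H1.
have [] := @principal_ideal_theorem P P1 P2 x => //.
  by move=> s21; apply: nP1x; apply: s21.
move=> P' [pP' sPP' P'x sP'2 n2P']; exists P'; split=> //.
by exists P2; split.
Qed.

(** Induction on [xs]: at the cost of one step, [chain_through] lets the chain start at a prime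
    containing the first generator. *)
Lemma krull_height n P Q xs : primeI P -> primeI Q ->
    (forall P', primeI P' -> span P xs [<=] P' -> Q [<=] P') ->
    (forall x, x \in xs -> Q x) ->
  prime_height_ge n P Q -> (n <= size xs)%N.
Proof.
move=> + pQ; elim: xs n P => [|x xs IHxs] [|n] P pP //= Qmin Qxs.
  move=> [P' [pP' sPP' nP' /prime_height_ge_sub sP'Q]].
  by case: nP'; apply: isub_trans sP'Q (Qmin _ _ _).
move=> /(@chain_through _ _ _ x pP pQ)[|P1 [pP1 sPP1 P1x H1]].
  by apply: Qxs; rewrite mem_head.
rewrite ltnS; apply: (IHxs n P1) => // [P' pP' sP'|y ys].
  apply: Qmin => //; apply: span_sub => [|y ys].
    apply: adj_sub; first by apply: isub_trans sPP1 (isub_trans _ sP'); apply: sub_span.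
    by apply: sP'; apply: sub_span.
  by apply: sP'; apply: mem_span.
by apply: Qxs; rewrite in_cons ys orbT.
Qed.

End KrullHeight.

Lemma Forall_In A (F : A -> Prop) s x : List.Forall F s -> List.In x s -> F x.
Proof. by move/List.Forall_forall; apply. Qed.

(** * Regular sequences and depth *)

Section RegularSequences.
Variable R : comNzRingType.
Implicit Types (I J K L N P Q a b : ideal R) (x y z u v w : R) (xs ys s t : seq R).

Definition regel J x := forall y, J (x * y) -> J y.

Fixpoint regs J xs := if xs is x :: xs' then regel J x /\ regs (adj J x) xs' else True.

(** This is [(J : a) = J], a form that passes directly from [(J, y)] to [(J, x)]; [common_regular]
    turns it into a regular element of [a]. *)
Definition faithful_on J a := forall u, (forall c, a c -> J (c * u)) -> J u.

(* [(b : a) / b] is isomorphic to [R / a], generated by the class of [w]. *)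
Definition colon_cyclic a b := exists w,
  [/\ forall c, a c -> b (w * c), forall r, b (r * w) -> a r &
      forall u, (forall c, a c -> b (u * c)) -> exists r, b (u - r * w)].

Lemma regel_faithful J a x : a x -> regel J x -> faithful_on J a.
Proof. by move=> ax rx u Hu; apply: rx; apply: Hu. Qed.

(** A relation [x * u = z * v] modulo [J] forces [v] into [(J, x)], and then [x] cancels. *)
Lemma regel_swap J x z : regel J x -> regel (adj J x) z -> regel (adj J z) x.
Proof.
move=> rx rz u [v Jv].
have [|e Je] := rz v.
  by exists u; apply: (imem1 (c := -1) Jv); ring.
exists e; apply: rx.
by apply: (imem2 (c1 := 1) (c2 := z) Jv Je); ring.
Qed.

(** Multiplying by [y] and dividing by [x] carries [(J, x) : a] into [(J, y) : a], injectively on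
    classes. *)
Lemma faithful_exchange J a x y : a x -> a y -> regel J x -> regel J y ->
  faithful_on (adj J y) a -> faithful_on (adj J x) a.
Proof.
move=> ax ay rx ry Hy u Hu.
have [u' Ju'] := Hu y ay.
have [|e Je] := Hy u'.
  move=> c ac; have [f Jf] := Hu c ac; exists f; apply: rx.
  by apply: (imem2 (c1 := - c) (c2 := y) Ju' Jf); ring.
exists e; apply: ry.
by apply: (imem2 (c1 := 1) (c2 := x) Ju' Je); ring.
Qed.

(* If [x u = y v] modulo [J], then [u] lies in [(J, y) : a] iff [v] lies in
   [(J, x) : a], and [u |-> v] is an isomorphism of the two colon modules. *)
Lemma colon_cyclic_exchange J a x y : a x -> a y -> regel J x -> regel J y ->
  colon_cyclic a (adj J y) -> colon_cyclic a (adj J x).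
Proof.
move=> ax ay rx ry [w [wa waP wgen]].
have [v Jv] := wa x ax.
exists v; split.
- move=> c ac; have [e Je] := wa c ac; exists e; apply: ry.
  by apply: (imem2 (c1 := - c) (c2 := x) Jv Je); ring.
- move=> r [e Je]; apply: waP; exists e; apply: rx.
  by apply: (imem2 (c1 := r) (c2 := y) Jv Je); ring.
- move=> u Hu; have [u' Ju'] := Hu y ay.
  have [|r [e Je]] := wgen u'.
    move=> c ac; have [e Je] := Hu c ac; exists e; apply: rx.
    by apply: (imem2 (c1 := - c) (c2 := y) Ju' Je); ring.
  exists r; exists e; apply: ry.
  by apply: (imem3 (c1 := 1) (c2 := x) (c3 := r) Ju' Je Jv); ring.
Qed.

Lemma colon_cyclic_refl a : colon_cyclic a a.
Proof.
exists 1; split=> [c ac|r|u _].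
- by apply: (imem_eq ac); ring.
- by rewrite mulr1.
- by exists u; apply: imem0; ring.
Qed.

Lemma regs_cat J s t : regs J (s ++ t) <-> regs J s /\ regs (span J s) t.
Proof. by elim: s J => [|x s IHs] J /=; rewrite ?IHs; tauto. Qed.

Lemma regs_rcons J s x : regs J (rcons s x) <-> regs J s /\ regel (span J s) x.
Proof. by rewrite -cats1 regs_cat /=; tauto. Qed.

Lemma regsP J xs :
  regs J xs <-> forall i, (i < size xs)%N -> regel (span J (take i xs)) xs`_i.
Proof.
elim: xs J => [|x xs IHxs] J /=; first by split.
rewrite IHxs; split=> [[rx Hxs] [|i] //= lti|H].
  exact: Hxs.
by split=> [|i lti]; [apply: (H 0%N)|apply: (H i.+1)].
Qed.

Fixpoint partial_spans J s :=
  J :: if s is x :: s' then partial_spans (adj J x) s' else [::].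

Lemma span_partial_spans J s : List.In (span J s) (partial_spans J s).
Proof. by elim: s J => [|x s IHs] J /=; [left|right]. Qed.

Lemma regs_adj J s z : regs J s ->
  List.Forall (fun K => regel K z) (partial_spans J s) -> regs (adj J z) s.
Proof.
elim: s J => //= x s IHs J [rx rs] Hz.
have {}Hz := List.Forall_inv_tail Hz; split; last by rewrite adjAC; apply: IHs.
apply: regel_swap => //; apply: (Forall_In Hz).
by case: s {IHs rs Hz} => [|y s]; left.
Qed.

(** Each partial ideal of [s] is followed by an element of [rcons s x] that is regular modulo it;
    for the last one this is [x]. *)
Lemma faithful_partial_spans J a s x : (forall y, y \in rcons s x -> a y) ->
  regs J (rcons s x) -> List.Forall (fun K => faithful_on K a) (partial_spans J s).
Proof.
elim: s J => [|y s IHs] J /= as_ [ry rs]; constructor => //.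
- by apply: regel_faithful ry; apply: as_; rewrite mem_head.
- by apply: regel_faithful ry; apply: as_; rewrite mem_head.
- by apply: IHs => // z zs; apply: as_; rewrite in_cons zs orbT.
Qed.

Section Noetherian.
Hypothesis noethR : noetherian R.

(** Regularity modulo [J] means avoiding the finitely many associated primes of [J]. By faithfulness
    none of them contains [a], so prime avoidance serves all [Js] at once. *)
Lemma common_regular a (Js : seq (ideal R)) :
    List.Forall (fun J => faithful_on J a) Js ->
  exists2 z, a z & List.Forall (fun J => regel J z) Js.
Proof.
move=> HJs.
have [Ps [HPs asPs]] : exists Ps, List.Forall (fun P => primeI P /\ ~ a [<=] P) Ps /\
    List.Forall (fun J => forall P, assI J P -> List.In P Ps) Js.
  elim: Js HJs => [|J Js IHJs] HJs; first by exists [::].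
  have [Ps [HPs asPs]] := IHJs (List.Forall_inv_tail HJs).
  have [Qs HQs] := finite_ass noethR J.
  exists (List.filter (fun P => `[< assI J P >]) Qs ++ Ps); split.
    apply/List.Forall_app; split=> //; apply/List.Forall_forall => P.
    move=> /List.filter_In[_ /asboolP [pP [u [nJu eP]]]]; split=> // saP.
    apply: nJu; apply: (List.Forall_inv HJs) => c /saP.
    by rewrite eP.
  constructor.
    move=> P asP; apply/List.in_or_app; left; apply/List.filter_In.
    by split; [apply: HQs|apply/asboolP].
  apply: List.Forall_impl asPs => K HK P /HK inP.
  by apply/List.in_or_app; right.
have [z az Hz] := prime_avoidance HPs; exists z => //.
apply: List.Forall_impl asPs => J HJ y Jzy; apply: contrapT => nJy.
have [P asP sP] := exists_ass noethR nJy.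
by case: (Forall_In Hz (HJ P asP)); apply: sP.
Qed.

Lemma colon_cyclic_regs n J a xs ys : size xs = n -> size ys = n ->
    (forall x, x \in xs -> a x) -> (forall y, y \in ys -> a y) ->
    regs J xs -> regs J ys ->
  colon_cyclic a (span J xs) -> colon_cyclic a (span J ys).
Proof.
elim: n J xs ys => [|n IHn] J xs ys.
  by move=> /eqP/nilP-> /eqP/nilP->.
case/lastP: xs => [//|xs x]; case/lastP: ys => [//|ys y].
rewrite !size_rcons => -[sx] [sy] axs ays rxs rys.
have [z az] : exists2 z, a z &
    List.Forall (fun K => regel K z) (partial_spans J xs ++ partial_spans J ys).
  apply: common_regular; apply/List.Forall_app.
  by split; apply: faithful_partial_spans; [exact: axs| |exact: ays|].
move=> /List.Forall_app[zxs zys].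
have [{}rxs rx] := (regs_rcons _ _ _).1 rxs.
have [{}rys ry] := (regs_rcons _ _ _).1 rys.
rewrite !span_rcons => Hx.
have spanC s : adj (span J s) z = span (adj J z) s.
  rewrite -span_rcons -[adj J z]/(span J [:: z]) -span_cat.
  by apply: span_perm; rewrite perm_rcons.
apply: (@colon_cyclic_exchange _ _ _ z) => //.
- by apply: ays; rewrite mem_rcons mem_head.
- exact: Forall_In zys (span_partial_spans J ys).
rewrite spanC; apply: (IHn _ xs) => //.
- by move=> u uxs; apply: axs; rewrite mem_rcons in_cons uxs orbT.
- by move=> u uys; apply: ays; rewrite mem_rcons in_cons uys orbT.
- exact: regs_adj.
- exact: regs_adj.
rewrite -spanC; apply: colon_cyclic_exchange Hx => //.
- by apply: axs; rewrite mem_rcons mem_head.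
- exact: Forall_In zxs (span_partial_spans J xs).
Qed.

Lemma colon_stable J x : exists k : nat, forall r, J (r * x ^+ k.+1) -> J (r * x ^+ k).
Proof.
pose F K := exists k : nat, K = colon J (x ^+ k).
have [|K [[k ->] _ Kmax]] := @noeth_max _ noethR F (colon J 1).
  by exists 0%N.
exists k => r Jr; apply: (Kmax (colon J (x ^+ k.+1))) => //; first by exists k.+1.
by move=> s /= Js; apply: (imem1 (c := x) Js); rewrite exprS; ring.
Qed.

End Noetherian.
End RegularSequences.

(** * Depth, associated primes and systems of parameters over a local ring *)

Section Local.
Variable R : comNzRingType.
Hypothesis noethR : noetherian R.
Variable m : ideal R.
Hypotheses (m1 : ~ m 1) (m_unit : forall u, ~ m u -> exists v, v * u = 1).
Implicit Types (I J K L N P Q a b : ideal R) (x y z u v w : R) (xs ys s t : seq R).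

Lemma m_prime : primeI m.
Proof.
split=> // x y mxy; apply: contrapT => /not_orP[nmx nmy].
have [v ev] := m_unit nmx.
by apply: nmy; apply: (imem1 (c := v) mxy); rewrite mulrA ev mul1r.
Qed.

Lemma proper_sub_m I : ~ I 1 -> I [<=] m.
Proof.
move=> I1 x Ix; apply: contrapT => nmx; have [v ev] := m_unit nmx; apply: I1.
by apply: (imem1 (c := v) Ix); rewrite ev.
Qed.

Lemma prime_sub_m P : primeI P -> P [<=] m.
Proof. by case=> P1 _; apply: proper_sub_m. Qed.

Lemma local_nakayama N K : N [<=] iadd K (imul m N) -> N [<=] K.
Proof.
move=> HN x Nx; have /(_ x Nx)[s nms Ks] : N [<=] sat m_prime K.
  apply: (nakayama noethR (B := m)) => //.
  exact: isub_trans HN (@sub_sat _ _ m_prime _).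
have [v ev] := m_unit nms.
by apply: (imem1 (c := v) Ks); rewrite mulrA ev mul1r.
Qed.

(* If [N] is the intersection, an ideal [L] maximal for [L :&: N = J + m N] contains a
   power of each element of [m], hence [N]; then Nakayama applies. *)
Lemma krull_intersection J zs y : (forall z, z \in zs -> m z) ->
  (forall n, (0 < n)%N -> span J [seq z ^+ n | z <- zs] y) -> J y.
Proof.
move=> mzs.
pose Nmem y := forall n, (0 < n)%N -> span J [seq z ^+ n | z <- zs] y.
have N0 : Nmem 0 by move=> n _; apply: ideal_mem0.
have ND c u v : Nmem u -> Nmem v -> Nmem (c * u + v).
  by move=> Hu Hv n n0; apply: ideal_memPD; [apply: Hu|apply: Hv].
pose N := Ideal N0 ND; move: y; rewrite -/(N [<=] J).
apply: local_nakayama.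
pose F L := forall u, L u -> N u -> iadd J (imul m N) u.
have [|L [FL sL Lmax]] := @noeth_max _ noethR F (iadd J (imul m N)); first by move=> u.
have LX x : m x -> exists k, L (x ^+ k).
  move=> mx; have [k Hk] := colon_stable noethR L x; exists k.
  apply: (Lmax (adj L (x ^+ k))); [|exact: sub_adj|exact: mem_adj].
  move=> u [c Lc] Nu; apply: FL => //.
  have Lxu : L (x * u) by apply: sL; apply: iaddr; apply: mem_imul.
  have /Hk Lcx : L (c * x ^+ k.+1).
    by apply: (imem2 (c1 := 1) (c2 := - x) Lxu Lc); rewrite exprS; ring.
  by apply: (imem2 (c1 := 1) (c2 := 1) Lc Lcx); ring.
have [n n0 Hn] : exists2 n, (0 < n)%N & forall z, z \in zs -> L (z ^+ n).
  elim: zs mzs {Nmem N0 ND N F FL sL Lmax} => [|z zs IHzs] mzs; first by exists 1%N.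
  have [|n n0 Hn] := IHzs; first by move=> u uzs; apply: mzs; rewrite in_cons uzs orbT.
  have [|k Lk] := LX z; first by apply: mzs; rewrite mem_head.
  exists (n + k)%N => [|u]; first by rewrite addn_gt0 n0.
  rewrite in_cons exprD => /orP[/eqP->|/Hn Lu]; first exact: imemM.
  by rewrite mulrC; apply: imemM.
move=> u Nu; apply: FL => //; move: (Nu n n0); apply: span_sub.
  exact: isub_trans (@iaddl _ J _) sL.
by move=> _ /mapP[z /Hn Lz ->].
Qed.

Fixpoint depth_ge k J :=
  if k is k'.+1 then exists x, [/\ m x, regel J x & depth_ge k' (adj J x)] else True.

Lemma regs_depth_ge J xs : (forall x, x \in xs -> m x) -> regs J xs ->
  depth_ge (size xs) J.
Proof.
elim: xs J => //= x xs IHxs J mxs [rx rxs]; exists x; split=> //.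
  by apply: mxs; rewrite mem_head.
by apply: IHxs => // y ys; apply: mxs; rewrite in_cons ys orbT.
Qed.

(** The element [y] supplied by the depth may differ from [x]. Some [z] regular modulo [J], [(J, x)]
    and [(J, y)] links them: induction passes from [(J, y)] to [(J, y, z)] and from [(J, z)] to
    [(J, z, x)]. *)
Lemma depth_ge_adj k J x : depth_ge k.+1 J -> m x -> regel J x -> depth_ge k (adj J x).
Proof.
elim: k J x => [//|k IHk] J x [y [my ry Dy]] mx rx.
have fy : faithful_on (adj J y) m.
  by case: Dy => y' [my' ry' _]; apply: regel_faithful ry'.
have fx : faithful_on (adj J x) m by apply: faithful_exchange fy.
have [|z mz Hz] := @common_regular _ noethR m [:: J; adj J x; adj J y].
  by do !constructor => //; apply: regel_faithful rx.
have rz := List.Forall_inv Hz; have {}Hz := List.Forall_inv_tail Hz.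
have rxz := List.Forall_inv Hz; have ryz := List.Forall_inv (List.Forall_inv_tail Hz).
exists z; split=> //; rewrite adjAC; apply: (IHk) => //; last exact: regel_swap.
exists y; split=> //; first exact: regel_swap.
by rewrite adjAC; apply: IHk.
Qed.

(** Depth is bounded by the dimension of [R / P]. Since [J : P] exceeds [J], by Nakayama it is not
    inside [(J, z)]; an element outside yields an associated prime of [(J, z)] containing [P] and
    [z], while [z] is not in [P]. *)
Lemma ass_height k J P : J [<=] m -> depth_ge k J -> assI J P -> prime_height_ge k P m.
Proof.
elim: k J P => [|k IHk] J P sJm; first by move=> _ [pP _]; apply: prime_sub_m.
move=> [z [mz rz Dz]] [pP [u [nJu eP]]].
pose Nmem n := forall p, P p -> J (p * n).
have N0 : Nmem 0 by move=> p _; apply: imem0; ring.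
have ND c v w : Nmem v -> Nmem w -> Nmem (c * v + w).
  move=> Nv Nw p Pp.
  by apply: (imem2 (c1 := c) (c2 := 1) (Nv p Pp) (Nw p Pp)); ring.
pose N := Ideal N0 ND.
have /existsNP[n /not_implyP[Nn nJn]] : ~ N [<=] adj J z.
  move=> HN; apply: nJu; apply: (@local_nakayama N J); last by move=> p; rewrite eP.
  move=> n Nn; have [c Jc] := HN n Nn; exists (n - c * z) => //.
  apply: (@imem_eq _ _ (z * c)); last by ring.
  apply: mem_imul => // p Pp; apply: rz.
  by apply: (imem2 (c1 := 1) (c2 := - p) (Nn p Pp) Jc); ring.
have [P' asP' sP'] := exists_ass noethR nJn.
exists P'; split; [by case: asP'| | |].
- move=> p Pp; apply: sP' => /=; apply: sub_adj; exact: Nn.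
- move=> sP'P; apply: nJu; apply: rz.
  have : P z by apply: sP'P; apply: sP'; exists n; apply: imem0; ring.
  by rewrite eP.
- apply: IHk asP' => //; apply: adj_sub => //.
Qed.

(** If [x] were a zero divisor modulo [J], it would lie in an associated prime [P]. The remaining
    elements would then generate an ideal with radical [m] modulo [P], so the height theorem would
    contradict [ass_height] by one. *)
Lemma sop_regs J xs : J [<=] m -> (forall x, x \in xs -> m x) ->
    (forall P, primeI P -> span J xs [<=] P -> m [<=] P) ->
  depth_ge (size xs) J -> regs J xs.
Proof.
elim: xs J => //= x xs IHxs J sJm mxs prim D.
have mx : m x by apply: mxs; rewrite mem_head.
have {}mxs y : y \in xs -> m y by move=> ys; apply: mxs; rewrite in_cons ys orbT.
have rx : regel J x.
  move=> u Jxu; apply: contrapT => nJu.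
  have [P asP sP] := exists_ass noethR nJu.
  have := @ass_height (size xs).+1 J P sJm D asP; have [pP [v [nJv eP]]] := asP.
  move=> /(krull_height noethR pP m_prime (xs := xs)).
  rewrite ltnn => H; apply/notF/H => // P' pP' sP'; apply: prim => //.
  apply: span_sub => [|y ys]; last by apply: sP'; apply: mem_span.
  apply: isub_trans sP'; apply: isub_trans (@sub_span _ _ _).
  apply: adj_sub; last exact: sP.
  by move=> w Jw; rewrite eP; apply: (imem1 (c := v) Jw); ring.
split=> //; apply: IHxs => //; first exact: adj_sub.
exact: (@depth_ge_adj (size xs)).
Qed.

(** The ideal generated by [xs] has radical [m]; the length is left free and is fixed separately by
    [krull_dim R (size xs)]. *)
Definition sop xs := (forall x, x \in xs -> m x) /\
  (forall P, primeI P -> span (izero R) xs [<=] P -> m [<=] P).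

(* As long as [xs] is not m-primary, avoiding the minimal primes of [xs] gives a new
   element which raises the height by one; [krull_height] makes this stop. *)
Lemma sop_exists : exists xs P0, [/\ sop xs, primeI P0 & prime_height_ge (size xs) P0 m].
Proof.
have [gs Hgs] := ideal_fg noethR m.
pose F n := exists xs, [/\ size xs = n, forall x, x \in xs -> m x &
  forall Q, primeI Q -> span (izero R) xs [<=] Q ->
    exists2 P0, primeI P0 & prime_height_ge n P0 Q].
have Fm n : F n -> exists2 P0, primeI P0 & prime_height_ge n P0 m.
  move=> [xs [_ mxs H]]; apply: H => //; first exact: m_prime.
  by apply: span_sub => // x ->; apply: ideal_mem0.
have Fbound n : F n -> (n <= size gs)%N.
  move=> /Fm[P0 pP0 H]; apply: (krull_height noethR pP0 m_prime _ _ H).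
    move=> P' pP' sP'; rewrite {1}Hgs; apply: span_sub => [x -> |x xgs].
      exact: ideal_mem0.
    by apply: sP'; apply: mem_span.
  by move=> x xgs; rewrite Hgs; apply: mem_span.
have F0 : F 0%N by exists [::]; split=> // Q pQ _; exists Q.
have [n [xs [sxs mxs Hxs]] nFn] : exists2 n, F n & ~ F n.+1.
  apply: contrapT => nF.
  suff /(_ (size gs).+1)/Fbound : forall n, F n by rewrite ltnn.
  elim=> // n Fn; apply: contrapT => nFn; apply: nF; by exists n.
have [|P0 pP0 HP0] := Fm n; first by exists xs.
exists xs, P0; split=> //; last by rewrite sxs.
split=> //.
have [Ps [HPs Pmin]] := finite_min_primes noethR (span (izero R) xs).
pose Qs := List.filter (fun P => `[< ~ m [<=] P >]) Ps.
apply: contrapT => /existsNP[P /not_implyP[pP /not_implyP[sP nmP]]].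
apply: nFn.
have [z mz Hz] : exists2 z, m z & List.Forall (fun P : ideal R => ~ P z) Qs.
  apply: prime_avoidance; apply/List.Forall_forall => Q /List.filter_In[inQ /asboolP nmQ].
  by split=> //; case: (Forall_In HPs inQ).
exists (rcons xs z); split; first by rewrite size_rcons sxs.
  by move=> x; rewrite mem_rcons in_cons => /orP[/eqP->|/mxs].
move=> Q pQ; rewrite span_rcons => sQ.
have sxQ : span (izero R) xs [<=] Q := isub_trans (@sub_adj _ _ _) sQ.
have Qz : Q z by apply: sQ; apply: mem_adj.
(* If the listed prime below [Q] contains [m], then [Q] contains [m] and hence [P], so a listed
   prime below [P] serves. *)
have [P' [inP' sP'Q nmP']] : exists P', [/\ List.In P' Ps, P' [<=] Q & ~ m [<=] P'].
  have [P' inP' sP'Q] := Pmin Q pQ sxQ.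
  have [smP'|] := pselect (m [<=] P'); last by exists P'.
  have [P'' inP'' sP''P] := Pmin P pP sP.
  exists P''; split=> //; last by move=> smP''; apply: nmP; apply: isub_trans sP''P.
  apply: isub_trans sP''P (isub_trans (prime_sub_m pP) (isub_trans smP' sP'Q)).
have [pP' sP'] := Forall_In HPs inP'.
have [P1 pP1 HP1] := Hxs P' pP' sP'.
exists P1 => [//|]; apply: (prime_height_geS HP1 pQ sP'Q) => sQP'.
apply: (Forall_In Hz (x := P')) (sQP' _ Qz).
by apply/List.filter_In; split=> //; apply/asboolP.
Qed.

(* For [k] large, [(J, x^(k+1)) : x] modulo [(J, x^(k+1))] is the direct sum of the
   nonzero module generated by [x^k] and of [(J : x) / J]; being cyclic over a local
   ring, it forces the second summand to vanish. *)
Lemma colon_cyclic_regel J x : m x -> (forall n, ~ J (x ^+ n)) ->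
  (forall n, colon_cyclic (adj J x) (adj J (x ^+ n.+1))) -> regel J x.
Proof.
move=> mx nJX Hcyc; have [k Hk] := colon_stable noethR J x.
have [w [wa _ wgen]] := Hcyc k; move=> t0 Jt0.
have gen u : adj J (x ^+ k.+1) (u * x) -> exists r, adj J (x ^+ k.+1) (u - r * w).
  move=> Hu; apply: wgen => c [e Je].
  have Je' : adj J (x ^+ k.+1) (c - e * x) by apply: sub_adj.
  by apply: (imem2 (c1 := e) (c2 := u) Hu Je'); ring.
have [al Jal] := wa x (mem_adj J x).
have [r [e Je]] : exists r, adj J (x ^+ k.+1) (x ^+ k - r * w).
  by apply: gen; exists 1; apply: imem0; rewrite exprS; ring.
have [r0 [e0 Je0]] : exists r, adj J (x ^+ k.+1) (t0 - r * w).
  by apply: gen; apply: sub_adj; apply: (imem_eq Jt0); ring.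
(* Multiplying [Je] by [x] and inserting [Jal] puts [(1 - r * al - x * e) * x ^+ k.+1] into [J]. For
   [r] in [m] the factor is a unit, so a power of [x] would lie in [J]. *)
have [mr|nmr] := pselect (m r).
  exfalso; apply: (nJX k).
  have [|v ev] := @m_unit (1 - r * al - x * e).
    move=> H; apply: m1.
    by apply: (imem3 (c1 := 1) (c2 := al) (c3 := e) H mr mx); ring.
  have -> : x ^+ k = 1 * x ^+ k by rewrite mul1r.
  apply: Hk; rewrite mul1r.
  have -> : x ^+ k.+1 = v * (1 - r * al - x * e) * x ^+ k.+1 by rewrite ev mul1r.
  apply: (imem2 (c1 := v * r) (c2 := v * x) Jal Je).
  rewrite exprS; ring.
(* Now [w], and so [t0], is a multiple of [x ^+ k] modulo [J]. As [x * t0] is in [J], the choice of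
   [k] puts this multiple into [J]. *)
have [v ev] := m_unit nmr.
have Jc : J (t0 - (r0 * v * (1 - x * e) + x * e0) * x ^+ k).
  apply: (imem2 (c1 := 1) (c2 := - (r0 * v)) Je0 Je).
  have -> : r0 * w = r0 * (v * r) * w by rewrite ev mulr1.
  rewrite exprS; ring.
have /Hk Jc' : J ((r0 * v * (1 - x * e) + x * e0) * x ^+ k.+1).
  by apply: (imem2 (c1 := 1) (c2 := - x) Jt0 Jc); rewrite exprS; ring.
by apply: (imem2 (c1 := 1) (c2 := 1) Jc Jc'); ring.
Qed.

End Local.

Local Open Scope quotient_scope.

(** * Homomorphisms between cyclic modules *)

Section Homs.
Variables (R : comNzRingType) (a b : idealr R).
Implicit Types c r u w : R.
Local Notation A := {ideal_quot a}.
Local Notation B := {ideal_quot b}.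

Lemma quot_scaleE (I : idealr R) c (x : R) :
  c *: (\pi_{ideal_quot I} x) = \pi_{ideal_quot I} (c * x).
Proof. by rewrite -[LHS]/(quot_scale c (\pi_{ideal_quot I} x)) /quot_scale -rmorphM. Qed.

Lemma quot_eq (I : idealr R) (x y : R) :
  (\pi_{ideal_quot I} x = \pi_{ideal_quot I} y) <-> x - y \in I.
Proof. by rewrite Quotient.idealrBE; split=> [/eqP|/eqP]. Qed.

Lemma rhomDZ c (f g : Rhom A B) x : (c *: f + g) x = c *: f x + g x.
Proof. by []. Qed.

Lemma rhomZE c (f : Rhom A B) x : (c *: f) x = c *: f x.
Proof. by []. Qed.

Lemma rhom_linear (f : Rhom A B) : linear f.
Proof. by have : rhom_fun f \in @linear_pred R A B := valP f; rewrite unfold_in => /asboolW. Qed.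

Lemma rhomZ (f : Rhom A B) c x : f (c *: x) = c *: f x.
Proof.
have f0 : f 0 = 0.
  have := rhom_linear f 1 0 0; rewrite scaler0 add0r scale1r => /eqP.
  by rewrite -subr_eq subrr eq_sym => /eqP.
by have := rhom_linear f c x 0; rewrite f0 !addr0.
Qed.

Lemma rhom_pi (f : Rhom A B) (x : R) : f (\pi_A x) = x *: f (\pi_A 1).
Proof. by rewrite -rhomZ quot_scaleE mulr1. Qed.

Lemma rhom_ext (f g : Rhom A B) : f (\pi_A 1) = g (\pi_A 1) -> f = g.
Proof.
move=> fg; apply: val_inj; apply/funext => x /=.
by rewrite -[x]reprK rhom_pi fg -rhom_pi.
Qed.

Lemma rhom_annihilates (f : Rhom A B) w : f (\pi_A 1) = \pi_B w ->
  forall c, c \in a -> w * c \in b.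
Proof.
move=> fw c ac.
have : f (\pi_A c) = f (\pi_A 0) by congr (f _); apply/quot_eq; rewrite subr0.
rewrite rhom_pi [RHS]rhom_pi fw !quot_scaleE => /quot_eq.
by rewrite mul0r subr0 mulrC.
Qed.

Lemma mul_rhom u : (forall c, c \in a -> u * c \in b) ->
  exists f : Rhom A B, f (\pi_A 1) = \pi_B u.
Proof.
move=> Hu; pose h (x : A) : B := \pi_B (u * repr x).
have hE x : h (\pi_A x) = \pi_B (u * x).
  by apply/quot_eq; rewrite -mulrBr; apply: Hu; apply/quot_eq; rewrite reprK.
have hlin : linear h.
  move=> c x y; rewrite -[x]reprK -[y]reprK quot_scaleE -rmorphD !hE.
  by rewrite quot_scaleE -rmorphD; congr (\pi_B _); ring.
have hP : h \in @linear_pred R A B by apply/asboolP.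
by exists (MkRhom hP); rewrite /= hE mulr1.
Qed.

(** Evaluation at the class of [1] identifies the homomorphisms with [(b : a) / b], in which [w]
    represents a generator with annihilator [a]. *)
Lemma hom_iso_colon :
  lmod_isomorphic (Rhom A B) A <-> exists w,
    [/\ forall c, c \in a -> w * c \in b, forall r, r * w \in b -> r \in a &
        forall u, (forall c, c \in a -> u * c \in b) -> exists r, u - r * w \in b].
Proof.
split=> [[F [G FK GK]]|[w [wa waP wgen]]].
  pose f := G (\pi_A 1); exists (repr (f (\pi_A 1))).
  have fw : f (\pi_A 1) = \pi_B (repr (f (\pi_A 1))) by rewrite reprK.
  have Ff r : F (r *: f) = \pi_A r by rewrite linearZ /= GK quot_scaleE mulr1.
  split; first exact: (rhom_annihilates fw).
    move=> r brw; have : r *: f = 0 *: f.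
      apply: rhom_ext; rewrite !rhomZE fw !quot_scaleE.
      by apply/quot_eq; rewrite mul0r subr0.
    by move=> /(congr1 F); rewrite !Ff => /quot_eq; rewrite subr0.
  move=> u /mul_rhom[h hu]; exists (repr (F h)).
  have : h = repr (F h) *: f by apply: (can_inj FK); rewrite Ff reprK.
  move=> /(congr1 (fun g : Rhom A B => g (\pi_A 1))).
  by rewrite hu rhomZE {1}fw quot_scaleE => /quot_eq.
(* The coefficient of [f] at the generator is unique modulo [a], which makes the chosen [F0] linear
   after projection. *)
have /choice[F0 HF0] (f : Rhom A B) : exists r, f (\pi_A 1) = \pi_B (r * w).
  have fw : f (\pi_A 1) = \pi_B (repr (f (\pi_A 1))) by rewrite reprK.
  by have [r Hr] := wgen _ (rhom_annihilates fw); exists r; rewrite {1}fw; apply/quot_eq.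
have /choice[G HG] (x : A) : exists f : Rhom A B, f (\pi_A 1) = \pi_B (repr x * w).
  by apply: mul_rhom => c ac; rewrite -mulrA; apply: idealMr; apply: wa.
pose F f : A := \pi_A (F0 f).
have Flin : linear F.
  move=> c f g; rewrite /F quot_scaleE -rmorphD; apply/quot_eq/waP.
  rewrite mulrBl; apply/quot_eq; rewrite -HF0 rhomDZ !HF0 quot_scaleE -rmorphD.
  by congr (\pi_B _); ring.
pose FM := GRing.isLinear.Build R (Rhom A B) A *:%R F Flin.
pose FL : {linear Rhom A B -> A} := HB.pack F FM.
exists FL; exists G => [f|x].
  apply: rhom_ext; rewrite HG HF0; apply/quot_eq; rewrite -mulrBl mulrC; apply: wa.
  by apply/quot_eq; rewrite reprK.
rewrite -[RHS]reprK; apply/quot_eq/waP; rewrite mulrBl; apply/quot_eq.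
by rewrite -HF0 HG.
Qed.

End Homs.

(** * Passage between boolean and propositional ideals *)

Section Bridge.
Variable R : comNzRingType.
Implicit Types (I : ideal R) (xs : seq R).

Lemma of_prime_idealr (p : prime_idealr R) : primeI (of_idealr p).
Proof.
split=> [|x y /=]; first exact: of_idealr1.
by rewrite prime_idealrM => /orP.
Qed.

Lemma to_prime_idealr I : primeI I -> exists p : prime_idealr R, of_idealr p = I.
Proof.
move=> [I1 IM]; have [a aI] := to_idealr I1.
have a_prime : prime_idealr_closed (a : pred R).
  by move=> x y axy; apply/orP; move: axy (IM x y); rewrite -aI => axy; apply.
pose p : prime_idealr R := HB.pack (Idealr.sort a) a (isPrimeIdealrClosed.Build R a a_prime).
by exists p; rewrite -aI; apply: ideal_ext.
Qed.

Lemma generates_span xs (a : idealr R) : generates xs a <-> of_idealr a = span (izero R) xs.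
Proof.
split=> [H|H y]; last by rewrite in_spanP -H.
by apply: ideal_ext => x; rewrite -in_spanP; apply H.
Qed.

Lemma hom_iso_colon_cyclic (a b : idealr R) :
  lmod_isomorphic (Rhom {ideal_quot a} {ideal_quot b}) {ideal_quot a} <->
  colon_cyclic (of_idealr a) (of_idealr b).
Proof. exact: hom_iso_colon. Qed.

Lemma regular_seq_regs xs : regular_seq xs -> regs (izero R) xs.
Proof.
by case=> H _; apply/regsP => i lti y /in_spanP Hy; apply/in_spanP; apply: H.
Qed.

End Bridge.

(** * Cohen-Macaulay local rings *)

Section LocalRing.
Variable R : comNzRingType.
Hypothesis noethR : noetherian R.
Variable m : idealr R.
Hypothesis localR : local_ring m.
Local Notation M := (of_idealr m).
Implicit Types (P Q : ideal R) (xs : seq R).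

Lemma local_unit u : ~ M u -> exists v, v * u = 1.
Proof.
move=> nmu; apply: contrapT => /forallNP nu.
have [|J [J1 sJ Jmax]] := @maxI_above _ noethR (adj (izero R) u).
  by move=> -[c] /eqP; rewrite subr_eq0 => /eqP ec; apply: (nu c).
have [j ej] := to_idealr J1; subst J.
apply: nmu; rewrite /= -(localR.2 j); first exact: sJ (mem_adj _ _).
by move=> J sjJ x Jx; apply: (Jmax (of_idealr J)) => //; apply: of_idealr1.
Qed.

Let M1 := @of_idealr1 _ m.
Let M_prime := m_prime M1 local_unit.

Lemma chain_height n (P : 'I_n.+1 -> prime_idealr R) : prime_chain P ->
  prime_height_ge n (of_idealr (P ord0)) M.
Proof.
elim: n P => [|n IHn] P HP; first exact/(prime_sub_m local_unit)/of_prime_idealr.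
exists (of_idealr (P (lift ord0 ord0))).
have [sP nP] := HP ord0 (lift ord0 ord0) isT.
split=> //; first exact: of_prime_idealr.
by apply: (IHn (fun i => P (lift ord0 i))) => i j ltij; apply: HP.
Qed.

Lemma height_chain n P : primeI P -> prime_height_ge n P M ->
  exists Q : 'I_n.+1 -> prime_idealr R, prime_chain Q /\ of_idealr (Q ord0) = P.
Proof.
elim: n P => [|n IHn] P pP.
  move=> _; have [p eP] := to_prime_idealr pP; exists (fun=> p); split=> // i j.
  by rewrite !ord1.
move=> [P' [pP' sP nP /(IHn _ pP')[Q [HQ Q0]]]].
have [p eP] := to_prime_idealr pP.
exists (fun i => if unlift ord0 i is Some j then Q j else p).
split; last by rewrite unlift_none.
move=> i j; case: (unliftP ord0 j) => [j' ->|-> //].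
have sPj : P' [<=] of_idealr (Q j').
  rewrite -Q0; case: (unliftP ord0 j') => [k ek|-> //].
  by apply: (HQ ord0 j' _).1; rewrite ek.
case: (unliftP ord0 i) => [i' -> ltij|-> _]; first exact: HQ.
split=> [x px|sjp]; first by apply: sPj; apply: sP; rewrite -eP.
by apply: nP => x /sPj /sjp px; rewrite -eP.
Qed.

(** The given chain is the lower bound; the height theorem for [xs] bounds every chain from
    above. *)
Lemma krull_dim_sop xs P : sop M xs -> primeI P -> prime_height_ge (size xs) P M ->
  krull_dim R (size xs).
Proof.
move=> [mxs prim] pP /(height_chain pP)[Q [HQ _]]; split; first by exists Q.
move=> n P' /chain_height; apply: krull_height => //; first exact: of_prime_idealr.
move=> P'' pP'' sP''; apply: prim => //; apply: isub_trans sP''.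
apply: span_sub => [x ->|x]; first exact: ideal_mem0.
exact: mem_span.
Qed.

Lemma krull_dim_uniq d e : krull_dim R d -> krull_dim R e -> d = e.
Proof.
move=> [[P HP] Hd] [[Q HQ] He]; apply/eqP.
by rewrite eqn_leq (He _ _ HP) (Hd _ _ HQ).
Qed.

Lemma span_sop_sub xs : sop M xs -> span (izero R) xs [<=] M.
Proof. by case=> mxs _; apply: span_sub => // x ->; apply: ideal_mem0. Qed.

Lemma parameter_idealP (a : idealr R) : parameter_ideal m a <->
  exists xs, [/\ krull_dim R (size xs), sop M xs & of_idealr a = span (izero R) xs].
Proof.
split=> [[d [xs [dimR mxs /generates_span axs rad]]]|[xs [dimR sxs axs]]].
  exists xs; rewrite size_tuple; split=> //; split=> // P pP sP x.
  by move=> /rad[n axn]; apply: (primeX pP (n := n)); apply: sP; rewrite -axs.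
exists (size xs), (in_tuple xs); split=> //.
- by case: sxs.
- exact/generates_span.
- move=> y; split=> [my|[n ayn]].
    have [P pP|n] := @radical_primes _ noethR (of_idealr a) y; last by exists n.
    by rewrite axs => sP; apply: sxs.2 my.
  by apply: (primeX M_prime (n := n)); apply: (span_sop_sub sxs); rewrite -axs.
Qed.

Lemma sop_parameter_ideal xs : krull_dim R (size xs) -> sop M xs ->
  exists2 a, parameter_ideal m a & of_idealr a = span (izero R) xs.
Proof.
move=> dimR sxs; have [|a ea] := @to_idealr _ (span (izero R) xs).
  by move=> /(span_sop_sub sxs)/M1.
by exists a => //; apply/parameter_idealP; exists xs.
Qed.

(** Otherwise [s] alone would generate an ideal with radical [m], bounding the dimension by
    [size s]. *)
Lemma sop_rcons_not_nilpotent s x n : krull_dim R (size s).+1 ->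
  sop M (rcons s x) -> ~ span (izero R) s (x ^+ n).
Proof.
move=> dimR [mxs prim] sxn; have [[P HP] _] := dimR.
have := chain_height HP => /(krull_height noethR (of_prime_idealr _) M_prime (xs := s)).
rewrite ltnn => H; apply/notF/H.
  move=> P' pP' sP'; apply: prim => //; rewrite span_rcons; apply: adj_sub.
    apply: isub_trans sP'; apply: span_sub => [y ->|y ys]; first exact: ideal_mem0.
    exact: mem_span.
  apply: (primeX pP' (n := n)); apply: sP'; move: sxn; apply: span_sub => [y ->|y ys].
    exact: ideal_mem0.
  exact: mem_span.
by move=> y ys; apply: mxs; rewrite mem_rcons in_cons ys orbT.
Qed.

Lemma sop_radical xs ys : sop M xs -> (forall y, y \in ys -> M y) ->
  (forall x, x \in xs -> exists n, x ^+ n \in ys) -> sop M ys.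
Proof.
move=> [mxs prim] mys Hys; split=> // P pP sP; apply: prim => //.
apply: span_sub => [y ->|x /Hys[n xn]]; first exact: ideal_mem0.
by apply: (primeX pP (n := n)); apply: sP; apply: mem_span.
Qed.

Lemma cohen_macaulay_hom (a b : idealr R) : cohen_macaulay m ->
  parameter_ideal m a -> parameter_ideal m b -> {subset b <= a} ->
  colon_cyclic (of_idealr a) (of_idealr b).
Proof.
move=> [d [dimR [[rs [mrs /regular_seq_regs rrs srs]] _]]].
move=> /parameter_idealP[xs [/krull_dim_uniq/(_ dimR) dx sxs axs]].
move=> /parameter_idealP[ys [/krull_dim_uniq/(_ dimR) dy sys bys]] sba.
have sM : izero R [<=] M by move=> x ->; apply: ideal_mem0.
have depthR : depth_ge M d (izero R) by rewrite -srs; apply: regs_depth_ge.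
have regs_sop zs : sop M zs -> size zs = d -> regs (izero R) zs.
  by case=> mzs prim szs; apply: (sop_regs noethR M1 local_unit) => //; rewrite szs.
rewrite bys; apply: (colon_cyclic_regs noethR dx dy).
- by move=> x xxs; rewrite axs; apply: mem_span.
- move=> y yys; apply: sba; suff : of_idealr b y by [].
  by rewrite bys; apply: mem_span.
- exact: regs_sop.
- exact: regs_sop.
- by rewrite -axs; apply: colon_cyclic_refl.
Qed.

Lemma hom_cohen_macaulay :
  (forall a b : idealr R,
     parameter_ideal m a -> parameter_ideal m b -> {subset b <= a} ->
     colon_cyclic (of_idealr a) (of_idealr b)) ->
  cohen_macaulay m.
Proof.
move=> Hcyc; have [xs [P0 [sxs pP0 HP0]]] := sop_exists noethR M1 local_unit.
have dimR := krull_dim_sop sxs pP0 HP0.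
(* Condition (ii) for [(s, x)] and [(s, x ^+ n.+1)] makes the last parameter regular modulo the
   others. *)
have last_regel s x : size (rcons s x) = size xs -> sop M (rcons s x) ->
    regel (span (izero R) s) x.
  move=> ssx sopx; rewrite -ssx in dimR.
  apply: (colon_cyclic_regel noethR M1 local_unit).
  - by apply: sopx.1; rewrite mem_rcons mem_head.
  - by move=> n; apply: sop_rcons_not_nilpotent sopx; rewrite -(size_rcons s x).
  - move=> n.
    have sopn : sop M (rcons s (x ^+ n.+1)).
      apply: (sop_radical sopx) => y; rewrite mem_rcons in_cons => /orP[/eqP->|ys].
      + by rewrite exprSr; apply: imemM; apply: sopx.1; rewrite mem_rcons mem_head.
      + by apply: sopx.1; rewrite mem_rcons in_cons ys orbT.
      + by exists n.+1; rewrite mem_rcons mem_head.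
      + by exists 1%N; rewrite expr1 mem_rcons in_cons ys orbT.
    have [a pa ea] := sop_parameter_ideal dimR sopx.
    have [|b pb eb] := sop_parameter_ideal _ sopn; first by rewrite !size_rcons in dimR *.
    rewrite -!span_rcons -ea -eb; apply: Hcyc => // y by_.
    suff : of_idealr a y by [].
    have : of_idealr b y by [].
    rewrite ea eb !span_rcons; apply: adj_sub; first exact: sub_adj.
    by rewrite exprSr; apply: imemM; apply: mem_adj.
have rxs : regs (izero R) xs.
  apply/regsP => i lti y Hy.
  have exs : xs = take i xs ++ xs`_i :: drop i.+1 xs.
    by rewrite -drop_nth // cat_take_drop.
  set s := take i xs in exs Hy *; set x := xs`_i in exs Hy *.
  set t := drop i.+1 xs in exs.
  have inxs z : z \in xs = [|| z \in s, z == x | z \in t].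
    by rewrite exs mem_cat in_cons.
  (* Only a last parameter is known to be regular, so the powers of the later parameters [t] are
     placed before [x] and then removed by intersecting over [n]. *)
  apply: (krull_intersection noethR M1 local_unit (zs := t)).
    by move=> z zt; apply: sxs.1; rewrite inxs zt !orbT.
  move=> n n0; rewrite -span_cat; apply: (last_regel _ x); last first.
  - by rewrite span_cat; apply: sub_span.
  - apply: (sop_radical sxs) => z.
      rewrite mem_rcons in_cons mem_cat => /or3P[/eqP->|zs|/mapP[z' z't ->]].
      + by apply: sxs.1; rewrite inxs eqxx orbT.
      + by apply: sxs.1; rewrite inxs zs.
      + rewrite -(prednK n0) exprSr; apply: imemM; apply: sxs.1.
        by rewrite inxs z't !orbT.
    rewrite inxs => /or3P[zs|/eqP->|zt].
    + by exists 1%N; rewrite expr1 mem_rcons in_cons mem_cat zs orbT.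
    + by exists 1%N; rewrite expr1 mem_rcons mem_head.
    + by exists n; rewrite mem_rcons in_cons mem_cat (map_f (fun z => z ^+ n) zt) !orbT.
  - by rewrite [in RHS]exs size_rcons !size_cat size_map addnS.
exists (size xs); split=> //; split.
  exists xs; split=> //; first exact: sxs.1.
  split=> [i lti y /in_spanP Hy|/in_spanP/(span_sop_sub sxs)/M1 //].
  by apply/in_spanP; move/regsP: rxs => /(_ i lti); apply.
(* Depth is at most the dimension: an associated prime of the zero ideal starts a chain of primes of
   length [size rs]. *)
move=> rs mrs /regular_seq_regs rrs.
have sM : izero R [<=] M by move=> x ->; apply: ideal_mem0.
have n1 : ~ izero R 1 by move=> /sM/M1.
have [P asP _] := exists_ass noethR n1.
have := ass_height noethR M1 local_unit sM (regs_depth_ge (m := M) mrs rrs) asP.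
have [pP _] := asP; move=> /(height_chain pP)[Q [HQ _]].
exact: dimR.2 HQ.
Qed.

End LocalRing.

Theorem theorem1p1 (R : comNzRingType) (m : idealr R)
    (noethR : noetherian R) (localR : local_ring m) :
  cohen_macaulay m <->
  (forall a b : idealr R,
     parameter_ideal m a -> parameter_ideal m b -> {subset b <= a} ->
     lmod_isomorphic (Rhom {ideal_quot a} {ideal_quot b}) {ideal_quot a}).
Proof.
split=> [CM a b pa pb sba|H].
  apply/hom_iso_colon_cyclic.
  exact: (cohen_macaulay_hom noethR localR CM pa pb sba).
apply: hom_cohen_macaulay => // a b pa pb sba.
apply/hom_iso_colon_cyclic.
exact: H.
Qed.
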